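(* Let $1<p<\infty$. The space $\mathscr{M}_p$ of multipliers of $\ell^p_A$, with the multiplier norm, fails to satisfy LWP or UWP for any constant $C>0$ and exponent $r>1$. That is, for every $C>0$ and $r>1$, it is not true that \[ \|\phi+\psi\|_{\mathscr{M}_p}^r+C\|\phi-\psi\|_{\mathscr{M}_p}^r\le 2^{r-1}\big(\|\phi\|_{\mathscr{M}_p}^r+\|\psi\|_{\mathscr{M}_p}^r\big) \] for all $\phi,\psi\in\mathscr{M}_p$, and it is not true that \[ \|\phi+\psi\|_{\mathscr{M}_p}^r+C\|\phi-\psi\|_{\mathscr{M}_p}^r\ge 2^{r-1}\big(\|\phi\|_{\mathscr{M}_p}^r+\|\psi\|_{\mathscr{M}_p}^r\big) \] for all $\phi,\psi\in\mathscr{M}_p$.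
   Context: For $1\le p<\infty$, $\ell^p_A$ is the space of analytic functions $f(z)=\sum_{k\ge 0} f_k z^k$ on the open unit disk $\mathbb{D}$ whose Maclaurin coefficients are $p$-summable, with norm $\|f\|_p=(\sum_k|f_k|^p)^{1/p}$. An analytic function $\phi$ on $\mathbb{D}$ is a multiplier of $\ell^p_A$ if $\phi f\in\ell^p_A$ for every $f\in\ell^p_A$; the set of multipliers is denoted $\mathscr{M}_p$, with norm $\|\phi\|_{\mathscr{M}_p}=\sup\{\|\phi f\|_p: f\in\ell^p_A,\ \|f\|_p\le 1\}$. A normed space $\mathscr{X}$ satisfies the Lower Weak Parallelogram property (LWP) with constant $C>0$ and exponent $r>1$ if $\|x+y\|^r+C\|x-y\|^r\le 2^{r-1}(\|x\|^r+\|y\|^r)$ for all $x,y\in\mathscr{X}$; it satisfies the Upper Weak Parallelogram property (UWP) with constant $C>0$ and exponent $r>1$ if the reverse inequality holds for all $x,y\in\mathscr{X}$. *)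

(* Defs.v *)
From HB Require Import structures.
From mathcomp Require Import all_boot all_order all_algebra ring complex.
From mathcomp Require Import all_classical all_reals all_analysis.

Set Implicit Arguments.
Unset Strict Implicit.
Unset Printing Implicit Defensive.

Import Order.TTheory GRing.Theory Num.Theory.
Import numFieldNormedType.Exports.

Local Open Scope classical_set_scope.
Local Open Scope ring_scope.

(* R[i] packed as a numFieldType, so that its norm topology is inferred.  The
   library norm `|z| of z : Cplx R is itself a complex number; the real-valued
   modulus is Normc.normc. *)
Definition Cplx (R : realType) : numFieldType := R[i].

Definition modulus (R : realType) (z : Cplx R) : R := ComplexField.Normc.normc z.

Definition disk (R : realType) : Type := {z : Cplx R | `|z| < 1}.

Definition has_power_series (R : realType) (f : disk R -> Cplx R)
    (a : nat -> Cplx R) : Prop :=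
  forall z : disk R, series (fun k => a k * val z ^+ k) @ \oo --> f z.

Definition analytic_on_disk (R : realType) (f : disk R -> Cplx R) : Prop :=
  exists a, has_power_series f a.

Section Uniqueness.
Variable R : realType.

Lemma power_series_coef_eq0 (c : nat -> Cplx R) :
  has_power_series (fun=> 0) c -> forall n, c n = 0.
Proof.
move=> c0; elim/ltn_ind => n IHn; apply/eqP/negPn/negP => cn0.
have half1 : `|2^-1 : Cplx R| < 1.
  by rewrite ger0_norm ?invr_ge0// invf_lt1// ltr1n.
have [M M0 cM] : exists2 M : Cplx R, 0 < M &
    forall k, `|c k| * 2^-1 ^+ k <= M.
  have := c0 (Sub 2^-1 half1).
  move=> /cvgP/cvg_series_cvg_0/cvgP/cvg_seq_bounded.
  move=> /ex_strict_bound_gt0[M M0 cM]; exists M => // k.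
  apply: ltW; have := cM k I; rewrite /= normrM normrX (ger0_norm (x := 2^-1))//.
pose K := 2 * M * 2 ^+ n.+1.
have K0 : 0 < K by rewrite !mulr_gt0 ?exprn_gt0.
have cn_gt0 : 0 < `|c n| by rewrite normr_gt0.
have [t tE] : exists t, t = `|c n| / (4 * (`|c n| + K)) by eexists.
have cnK0 : 0 < `|c n| + K by rewrite addr_gt0.
have t0 : 0 < t by rewrite tE divr_gt0// mulr_gt0.
have t4 : t <= 4^-1.
  rewrite tE ler_pdivrMr ?mulr_gt0// mulrA mulVf ?pnatr_eq0// mul1r.
  by rewrite lerDl ltW.
have t1 : `|t| < 1.
  by rewrite gtr0_norm// (le_lt_trans t4)// invf_lt1// ltr1n.
have t2 : 0 <= 1 - 2 * t - 2^-1.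
  by rewrite (_ : _ - _ = 2 * (4^-1 - t)) ?mulr_ge0 ?subr_ge0//; field.
have tail N : `|\sum_(n.+1 <= k < n.+1 + N) c k * t ^+ k| <= K * t ^+ n.+1.
  apply: (le_trans (ler_norm_sum _ _ _)).
  apply: (@le_trans _ _ (\sum_(n.+1 <= k < n.+1 + N) M * (2 * t) ^+ k)).
    apply: ler_sum => k _; rewrite normrM normrX (gtr0_norm t0).
    rewrite exprMn mulrA; apply: ler_wpM2r; first by rewrite exprn_ge0 ?ltW.
    by rewrite -ler_pdivrMr ?exprn_gt0// -exprVn.
  rewrite -mulr_sumr geometric_partial_tail geometric_seriesE; last first.
    by rewrite -subr_eq0 -opprB oppr_eq0 gt_eqF// (@lt_le_trans _ _ 2^-1)// -subr_ge0.
  rewrite /= (_ : K * _ = M * ((2 * t) ^+ n.+1 * 2)); last first.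
    by rewrite /K exprMn; ring.
  rewrite ler_pM2l// -mulrA; apply: ler_wpM2l; first by rewrite exprn_ge0 ?mulr_ge0 ?(ltW t0).
  have tp : 0 < 1 - 2 * t by rewrite (@lt_le_trans _ _ 2^-1)// -subr_ge0.
  rewrite ler_pdivrMr//; apply: (@le_trans _ _ 1).
    by rewrite lerBlDr lerDl exprn_ge0 ?mulr_ge0 ?(ltW t0).
  by rewrite -ler_pdivrMl// mulr1 -subr_ge0.
have cvg_t := c0 (Sub t t1).
have : `|c n * t ^+ n| <= K * t ^+ n.+1.
  apply/ler_addgt0Pr => e e0.
  move/cvgrPdist_le : cvg_t => /(_ e e0)[N _ /(_ (n.+1 + N)%N)].
  rewrite /= leq_addl sub0r normrN => /(_ isT).
  rewrite /series /= (big_cat_nat _ (n := n.+1))//= ?leq_addr//.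
  rewrite big_nat_recr//= big_nat big1 ?add0r; last first.
    by move=> i /andP[_ /IHn ->]; rewrite mul0r.
  move=> hS; set T := (X in _ + X) in hS.
  rewrite -[X in `|X|](addrK T) (le_trans (ler_normB _ _))// addrC lerD//.
  exact: tail.
rewrite normrM normrX (gtr0_norm t0) exprSr mulrA mulrAC.
rewrite ler_pM2r ?exprn_gt0// => /(lt_le_trans _) h.
have /h : K * t < `|c n|; last by rewrite ltxx.
rewrite tE mulrCA gtr_pMr// ltr_pdivrMr ?mulr_gt0// mul1r.
rewrite (@lt_le_trans _ _ (`|c n| + K)) ?ltrDr//.
by rewrite ler_peMl ?ler1n// ltW.
Qed.

Lemma power_series_unique (f : disk R -> Cplx R) (a b : nat -> Cplx R) :
  has_power_series f a -> has_power_series f b -> a = b.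
Proof.
move=> fa fb; apply/funext => k; apply/eqP; rewrite -subr_eq0; apply/eqP.
apply: (@power_series_coef_eq0 (fun k => a k - b k)) => z.
rewrite -(subrr (f z)).
have -> : series (fun k => (a k - b k) * val z ^+ k) =
    series (fun k => a k * val z ^+ k) - series (fun k => b k * val z ^+ k).
  apply/funext => n; rewrite !fctE /series /= -sumrB.
  by apply: eq_bigr => i _; rewrite mulrBl.
exact: cvgB.
Qed.

End Uniqueness.

(* The Maclaurin coefficients of f, unique by power_series_unique; the value is
   0 when f is not analytic on the disk. *)
Definition maclaurin (R : realType) (f : disk R -> Cplx R) : nat -> Cplx R :=
  xget (fun=> 0) [set a | has_power_series f a].

Definition lpA (R : realType) (p : R) : set (disk R -> Cplx R) :=
  [set f | analytic_on_disk f /\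
           cvgn (series (fun k => modulus (maclaurin f k) `^ p))].

Definition lpA_norm (R : realType) (p : R) (f : disk R -> Cplx R) : R :=
  limn (series (fun k => modulus (maclaurin f k) `^ p)) `^ p^-1.

Definition multiplier (R : realType) (p : R) : set (disk R -> Cplx R) :=
  [set phi | analytic_on_disk phi /\
             forall f, lpA p f -> lpA p (fun z => phi z * f z)].

(* For a multiplier phi this set is bounded above (closed graph theorem), so the
   real-valued sup is the operator norm of multiplication by phi. *)
Definition multiplier_norm (R : realType) (p : R) (phi : disk R -> Cplx R) : R :=
  sup [set lpA_norm p (fun z => phi z * f z) |
        f in [set f | lpA p f /\ lpA_norm p f <= 1]].

(* The weak parallelogram properties of the normed space with underlying set X
   and norm N. *)
Definition LWP (R : realType) (V : zmodType) (X : set V) (N : V -> R)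
    (C r : R) : Prop :=
  forall x y : V, X x -> X y ->
    N (x + y) `^ r + C * N (x - y) `^ r <= 2 `^ (r - 1) * (N x `^ r + N y `^ r).

Definition UWP (R : realType) (V : zmodType) (X : set V) (N : V -> R)
    (C r : R) : Prop :=
  forall x y : V, X x -> X y ->
    N (x + y) `^ r + C * N (x - y) `^ r >= 2 `^ (r - 1) * (N x `^ r + N y `^ r).

(* Main.v *)
(* The multiplier norm of a + b z with real a, b is |a| + |b|, as for the
   classical l^1 norm on the plane, which is neither strictly convex nor smooth.
   LWP fails at 1 and z, since N(1 + z) = N(1) + N(z) while N(1 - z) > 0.
   UWP fails at 1 + t z and 1 - t z for small t > 0: it would give
   1 + C t^r >= (1 + t)^r >= 1 + t, although r > 1.
   The upper bound for the norm comes from the convexity of x^p, the lower one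
   from testing on truncated geometric series. *)

Require Import Defs.
From mathcomp Require Import all_boot all_order all_algebra ring lra complex.
From mathcomp Require Import all_classical all_reals all_analysis.

Import Order.TTheory GRing.Theory Num.Theory.
Import numFieldNormedType.Exports.

Local Open Scope ring_scope.

Section AffineMultipliers.

Set Implicit Arguments.
Unset Strict Implicit.
Local Open Scope classical_set_scope.

Variable R : realType.
Implicit Types (p : R) (a b s u v : Cplx R) (c : nat -> Cplx R).
Implicit Types (f : disk R -> Cplx R).

(** * Real-valued modulus of complex numbers *)

Lemma modulusM u v : modulus (u * v) = modulus u * modulus v.
Proof. exact: ComplexField.Normc.normcM. Qed.

Lemma modulusD u v : modulus (u + v) <= modulus u + modulus v.
Proof. exact: (@le_normcD R u v). Qed.

Lemma modulus_ge0 u : 0 <= modulus u.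
Proof. by case: u => x y; exact: sqrtr_ge0. Qed.

Lemma modulus0 : modulus (0 : Cplx R) = 0.
Proof. exact: ComplexField.Normc.normc0. Qed.

Lemma modulus_real (x : R) : modulus (x%:C%C : Cplx R) = `|x|.
Proof.
by rewrite /modulus /ComplexField.Normc.normc /= expr0n addr0 sqrtr_sqr.
Qed.

Lemma modulusX u n : modulus (u ^+ n) = modulus u ^+ n.
Proof.
elim: n => [|n IHn]; last by rewrite !exprS modulusM IHn.
exact: ComplexField.Normc.normc1.
Qed.

(** * Expansions of polynomials and of products with an affine function *)

Lemma cvg_series_eq0 (K : numFieldType) (u : nat -> K) N :
  (forall k, (N <= k)%N -> u k = 0) -> series u @ \oo --> series u N.
Proof.
move=> u0; apply: cvg_near_cst; exists N => // n /= Nn.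
rewrite /series /= (big_cat_nat _ (n := N))//= [X in _ + X]big_nat_cond.
by rewrite [X in _ + X]big1 ?addr0// => k /andP[/andP[/u0]].
Qed.

(** By uniqueness of coefficients, the chosen value [maclaurin f] can be computed from any expansion
    at hand. *)
Lemma maclaurin_eq f c : has_power_series f c -> maclaurin f = c.
Proof.
rewrite /maclaurin => fc; case: xgetP => [c' _ fc'|/(_ c)//].
exact: power_series_unique fc' fc.
Qed.

Lemma has_power_series_poly N c : (forall k, (N <= k)%N -> c k = 0) ->
  has_power_series (fun z => \sum_(0 <= k < N) c k * val z ^+ k) c.
Proof.
move=> c0 z; apply: (@cvg_series_eq0 (Cplx R) (fun k => c k * val z ^+ k)).
by move=> k /c0 ->; rewrite mul0r.
Qed.

Definition affine a b : disk R -> Cplx R := fun z => a + b * val z.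

(** Cauchy product of the coefficients of [a + b z] with [c]: the match is the right shift of [c],
    with 0 entering at index 0. *)
Definition affine_coef a b c k := a * c k + b * (if k is j.+1 then c j else 0).

Lemma has_power_series_affineM a b f c : has_power_series f c ->
  has_power_series (fun z => affine a b z * f z) (affine_coef a b c).
Proof.
move=> fc z; rewrite -cvg_shiftS.
(* Multiplication by [z] delays each term by one index: if [S] denotes the partial sums for [f],
   those of the product at [n.+1] are [a * S n.+1 + b * z * S n]. *)
rewrite [X in X @ _ --> _](_ : _ =
    (fun n => a * series (fun k => c k * val z ^+ k) n.+1 +
              b * val z * series (fun k => c k * val z ^+ k) n)); last first.
  apply/funext => n; rewrite /series /= big_nat_recl//= [in RHS]big_nat_recl//=.
  rewrite /affine_coef mulrDr !mulr_sumr -addrA -big_split/= !expr0; congr (_ + _).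
    by rewrite mulr0 addr0 !mulr1.
  by apply: eq_bigr => k _; rewrite exprS; ring.
rewrite /affine mulrDl; apply: cvgD; apply: cvgMl_tmp; last exact: fc.
by have := fc z; rewrite -cvg_shiftS.
Qed.

Arguments has_power_series_affineM a b {f c}.

(** * Coefficient estimates behind the upper bound *)

Lemma powR_modulus_le p a b u v : 1 <= p ->
  modulus (a * u + b * v) `^ p <=
  (modulus a + modulus b) `^ (p - 1) *
  (modulus a * modulus u `^ p + modulus b * modulus v `^ p).
Proof.
move=> p1; have p0 : 0 < p by exact: lt_le_trans p1.
set A := modulus a; set B := modulus b.
set U := modulus u; set V := modulus v.
have [A0 B0 U0 V0] : [/\ 0 <= A, 0 <= B, 0 <= U & 0 <= V].
  by split; exact: modulus_ge0.
apply: (@le_trans _ _ ((A * U + B * V) `^ p)).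
  apply: ge0_ler_powR; rewrite ?nnegrE ?modulus_ge0 ?addr_ge0 ?mulr_ge0 ?(ltW p0)//.
  by rewrite /A /U /B /V -!modulusM; exact: modulusD.
(* The weights [A / (A + B)] and [B / (A + B)] need a nonzero denominator; if it vanishes, so do [A]
   and [B], and both sides are 0. *)
have [AB0|AB0] := eqVneq (A + B) 0.
  have /andP[/eqP -> /eqP ->] : (A == 0) && (B == 0) by rewrite -paddr_eq0// AB0.
  by rewrite !mul0r addr0 powR0 ?gt_eqF// mulr_ge0 ?powR_ge0// addr0.
have AB : 0 < A + B by rewrite lt_neqAle eq_sym AB0 addr_ge0.
have t0 : 0 <= A / (A + B) by rewrite divr_ge0// ltW.
have t1 : A / (A + B) <= 1 by rewrite ler_pdivrMr// mul1r lerDl.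
have tB : 1 - A / (A + B) = B / (A + B) by field.
(* Jensen's inequality for the [p]-th power at [U] and [V], with weights proportional to [A] and
   [B]. *)
have := @convex_powR R p p1 (Itv01 t0 t1) U V.
rewrite !inE /= !in_itv /= !andbT => /(_ U0 V0).
rewrite /conv /= /conv /= /unstable.onem tB => h.
have {1}-> : A * U + B * V = (A + B) * (A / (A + B) * U + B / (A + B) * V).
  by field.
rewrite powRM ?addr_ge0 ?mulr_ge0 ?divr_ge0 ?invr_ge0 ?(ltW AB)//.
apply: (le_trans (ler_wpM2l (powR_ge0 _ _) h)).
rewrite powRB ?AB0 ?implybT// powRr1 ?(ltW AB)//.
by rewrite le_eqVlt; apply/orP; left; apply/eqP; rewrite /GRing.scale /=; field.
Qed.

(** The convexity estimate is summed over pairs of consecutive coefficients; the shifted sequence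
    [d] has no larger partial sums, which leaves the factor [(A + B)^(p-1) * (A + B)] with [A], [B]
    the moduli of [a], [b]. *)
Lemma sum_affine_coef_le p a b c n : 1 <= p ->
  \sum_(0 <= k < n) modulus (affine_coef a b c k) `^ p <=
  (modulus a + modulus b) `^ p * \sum_(0 <= k < n) modulus (c k) `^ p.
Proof.
move=> p1; have p0 : 0 < p by exact: lt_le_trans p1.
have A0 := modulus_ge0 a; have B0 := modulus_ge0 b.
pose d k := if k is j.+1 then c j else 0.
have le_d : \sum_(0 <= k < n) modulus (d k) `^ p <=
    \sum_(0 <= k < n) modulus (c k) `^ p.
  case: n => [|n]; first by rewrite !big_geq.
  rewrite big_nat_recl// modulus0 powR0 ?gt_eqF// add0r big_nat_recr//=.
  by rewrite lerDl powR_ge0.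
apply: (@le_trans _ _ (\sum_(0 <= k < n) (modulus a + modulus b) `^ (p - 1) *
    (modulus a * modulus (c k) `^ p + modulus b * modulus (d k) `^ p))).
  by apply: ler_sum => k _; exact: powR_modulus_le.
rewrite -mulr_sumr big_split/= -!mulr_sumr.
rewrite (_ : (modulus a + modulus b) `^ p =
  (modulus a + modulus b) `^ (p - 1) * (modulus a + modulus b)); last first.
  have [->|AB0] := eqVneq (modulus a + modulus b) 0.
    by rewrite mulr0 powR0// gt_eqF.
  by rewrite -[X in _ * X]powRr1 ?addr_ge0// -powRD ?subrK// AB0 implybT.
by rewrite -mulrA ler_wpM2l ?powR_ge0// mulrDl lerD2l ler_wpM2l.
Qed.

(** * Membership and norm read off from an explicit expansion *)

Lemma lpA_has_power_series p f c : has_power_series f c ->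
  lpA p f <-> cvgn (series (fun k => modulus (c k) `^ p)).
Proof.
by move=> fc; rewrite /lpA /= (maclaurin_eq fc); split=> [[]//|]; split=> //; exists c.
Qed.

Lemma lpA_norm_has_power_series p f c : has_power_series f c ->
  lpA_norm p f = limn (series (fun k => modulus (c k) `^ p)) `^ p^-1.
Proof. by move=> fc; rewrite /lpA_norm (maclaurin_eq fc). Qed.

Lemma lpA_power_series p f : lpA p f -> exists2 c, has_power_series f c &
  cvgn (series (fun k => modulus (c k) `^ p)).
Proof. by move=> [[c fc]]; rewrite (maclaurin_eq fc) => ?; exists c. Qed.

Lemma series_powR_nondecreasing p c :
  nondecreasing_seq (series (fun k => modulus (c k) `^ p)).
Proof. by apply: nondecreasing_series => k _ _; exact: powR_ge0. Qed.

Lemma series_powR_le_lim p c : cvgn (series (fun k => modulus (c k) `^ p)) ->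
  forall n, series (fun k => modulus (c k) `^ p) n <=
    limn (series (fun k => modulus (c k) `^ p)).
Proof. by move=> /nondecreasing_cvgn_le; apply; exact: series_powR_nondecreasing. Qed.

Lemma lim_series_powR_ge0 p c : cvgn (series (fun k => modulus (c k) `^ p)) ->
  0 <= limn (series (fun k => modulus (c k) `^ p)).
Proof.
by move=> /series_powR_le_lim/(_ 0%N); rewrite /series /= big_geq.
Qed.

Lemma cvg_series_affine p a b c : 1 <= p ->
  cvgn (series (fun k => modulus (c k) `^ p)) ->
  cvgn (series (fun k => modulus (affine_coef a b c k) `^ p)).
Proof.
move=> p1 cc; apply: nondecreasing_is_cvgn; first exact: series_powR_nondecreasing.
exists ((modulus a + modulus b) `^ p *
  limn (series (fun k => modulus (c k) `^ p))) => _ [n _ <-].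
apply: (le_trans (sum_affine_coef_le a b c n p1)).
by rewrite ler_wpM2l ?powR_ge0//; exact: series_powR_le_lim.
Qed.

(** * Affine functions as multipliers, and the upper bound for their norm *)

Lemma lpA_affineM p a b f : 1 <= p -> lpA p f ->
  lpA p (fun z => affine a b z * f z).
Proof.
move=> p1 /lpA_power_series[c fc cc].
apply/(lpA_has_power_series p (has_power_series_affineM a b fc)).
exact: cvg_series_affine.
Qed.

Lemma lpA_norm_affineM_le p a b f : 1 <= p -> lpA p f ->
  lpA_norm p (fun z => affine a b z * f z) <=
  (modulus a + modulus b) * lpA_norm p f.
Proof.
move=> p1 /lpA_power_series[c fc cc].
have p0 : 0 < p by exact: lt_le_trans p1.
have A0 := modulus_ge0 a; have B0 := modulus_ge0 b.
have ccab : cvgn (series (fun k => modulus (affine_coef a b c k) `^ p)) 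
  by exact: cvg_series_affine.
rewrite (lpA_norm_has_power_series p fc).
rewrite (lpA_norm_has_power_series p (has_power_series_affineM a b fc)).
have {1}-> : modulus a + modulus b = ((modulus a + modulus b) `^ p) `^ p^-1.
  by rewrite -powRrM divff ?gt_eqF// powRr1// addr_ge0.
rewrite -powRM ?powR_ge0 ?lim_series_powR_ge0//.
apply: ge0_ler_powR; rewrite ?nnegrE ?invr_ge0 ?mulr_ge0 ?powR_ge0
  ?lim_series_powR_ge0 ?(ltW p0)//.
apply: limr_le => //; apply: nearW => n.
apply: (le_trans (sum_affine_coef_le a b c n p1)).
by rewrite ler_wpM2l ?powR_ge0//; exact: series_powR_le_lim.
Qed.

Lemma multiplier_affine p a b : 1 <= p -> multiplier p (affine a b).
Proof.
move=> p1; split; last by move=> f; exact: lpA_affineM.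
exists (nth 0 [:: a; b]).
rewrite (_ : affine a b =
  fun z => \sum_(0 <= k < 2) nth 0 [:: a; b] k * val z ^+ k).
  by apply: has_power_series_poly => k k2; rewrite nth_default.
apply/funext => z; rewrite big_nat_recr//= big_nat1/=.
by rewrite expr0 mulr1 expr1.
Qed.

(** Serves both bounds: [sup] has default value 0 on sets not bounded above, so lower bounds
    obtained from test functions rely on it too. *)
Lemma multiplier_norm_affine_ubound p a b : 1 <= p ->
  ubound [set lpA_norm p (fun z => affine a b z * f z) |
           f in [set f | lpA p f /\ lpA_norm p f <= 1]]
         (modulus a + modulus b).
Proof.
move=> p1 _ [f [/= fp f1] <-].
apply: (le_trans (lpA_norm_affineM_le a b p1 fp)).
by rewrite ler_piMr// addr_ge0 ?modulus_ge0.
Qed.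

(** The zero function shows that the set under the supremum is nonempty and that the multiplier norm
    is nonnegative. *)
Lemma lpA_zero p : 0 < p ->
  lpA p (fun=> 0 : Cplx R) /\ lpA_norm p (fun=> 0 : Cplx R) = 0.
Proof.
move=> p0.
have h0 : has_power_series (fun=> 0 : Cplx R) (fun=> 0).
  rewrite [X in has_power_series X](_ : _ =
    fun z => \sum_(0 <= k < 0) (0 : Cplx R) * val z ^+ k).
    exact: (@has_power_series_poly 0).
  by apply/funext => z; rewrite big_geq.
have s0 : series (fun k : nat => modulus (0 : Cplx R) `^ p) @ \oo --> (0 : R).
  have z0 : modulus (0 : Cplx R) `^ p = 0 by rewrite modulus0 powR0// gt_eqF.
  have := @cvg_series_eq0 R (fun=> modulus (0 : Cplx R) `^ p) 0 (fun _ _ => z0).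
  by rewrite [X in _ --> X]/series /= big_geq.
split; first by apply/(lpA_has_power_series p h0); apply/cvg_ex; exists 0.
rewrite (lpA_norm_has_power_series p h0) (cvg_lim _ s0)//.
by rewrite powR0// invr_neq0// gt_eqF.
Qed.

Lemma multiplier_norm_affine_le p a b : 1 <= p ->
  multiplier_norm p (affine a b) <= modulus a + modulus b.
Proof.
move=> p1; have [z1 z2] := lpA_zero (lt_le_trans ltr01 p1).
apply: ge_sup; last exact: multiplier_norm_affine_ubound.
exists (lpA_norm p (fun z => affine a b z * 0)), (fun=> 0) => //.
by split => //=; rewrite z2.
Qed.

(** * Lower bound for the norm by test functions *)

Lemma le_lpA_norm_multiplier_norm p a b f : 1 <= p ->
  lpA p f -> lpA_norm p f <= 1 ->
  lpA_norm p (fun z => affine a b z * f z) <= multiplier_norm p (affine a b).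
Proof.
move=> p1 fp f1; apply: ub_le_sup; last by exists f.
by exists (modulus a + modulus b); exact: multiplier_norm_affine_ubound.
Qed.

Lemma multiplier_norm_affine_ge0 p a b : 1 <= p ->
  0 <= multiplier_norm p (affine a b).
Proof.
move=> p1; have [z1 z2] := lpA_zero (lt_le_trans ltr01 p1).
have := le_lpA_norm_multiplier_norm a b p1 z1.
by rewrite z2 => /(_ ler01); apply: le_trans; exact: powR_ge0.
Qed.

(* The normalized sum of the (s z)^k over k <= N is an approximate eigenvector
   of the shift, with eigenvalue s^-1. *)
Lemma multiplier_norm_affine_ge p a b s : 1 <= p -> modulus s = 1 ->
  modulus (a * s + b) <= multiplier_norm p (affine a b).
Proof.
move=> p1 s1; have p0 : 0 < p by exact: lt_le_trans p1.
set M := modulus _; set m := multiplier_norm _ _.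
have M0 : 0 <= M by exact: modulus_ge0.
have m0 : 0 <= m by exact: multiplier_norm_affine_ge0.
have key N : M `^ p * (N%:R / N.+1%:R) <= m `^ p.
  (* The test function has [N.+1] coefficients of modulus [g], and [g^p = 1 / N.+1] gives it norm
     1. *)
  pose g : R := N.+1%:R `^ - p^-1.
  pose c k : Cplx R := if (k < N.+1)%N then g%:C%C * s ^+ k else 0.
  have c0 k : (N.+1 <= k)%N -> c k = 0 by move=> kN; rewrite /c ltnNge kN.
  have cE k : (k < N.+1)%N -> modulus (c k) `^ p = N.+1%:R^-1.
    move=> kN; rewrite /c kN modulusM modulusX s1 expr1n mulr1 modulus_real.
    by rewrite ger0_norm ?powR_ge0// -powRrM mulNr mulVf ?gt_eqF// powR_inv1.
  have fc := has_power_series_poly c0.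
  have c1 : series (fun k => modulus (c k) `^ p) @ \oo --> (1 : R).
    have := @cvg_series_eq0 R (fun k => modulus (c k) `^ p) N.+1.
    rewrite {2}/series /= (eq_big_nat _ _ (F2 := fun=> N.+1%:R^-1)); last first.
      by move=> k /= /cE.
    rewrite sumr_const_nat subn0 -[X in X *+ _]mul1r -mulrnAr -mulr_natl.
    rewrite mul1r divff ?pnatr_eq0//; apply => k /c0 ->.
    by rewrite modulus0 powR0// gt_eqF.
  have cc : cvgn (series (fun k => modulus (c k) `^ p)) by apply/cvg_ex; exists 1.
  have /= := @le_lpA_norm_multiplier_norm p a b _ p1
    ((lpA_has_power_series p fc).2 cc).
  rewrite (lpA_norm_has_power_series p fc) (cvg_lim _ c1)// powR1 lexx.
  rewrite (lpA_norm_has_power_series p (has_power_series_affineM a b fc)).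
  move=> /(_ isT); rewrite -/m => hm.
  have ccab : cvgn (series (fun k => modulus (affine_coef a b c k) `^ p)) 
  by exact: cvg_series_affine.
  set E := limn _ in hm.
  have E0 : 0 <= E by exact: lim_series_powR_ge0.
  apply: (@le_trans _ _ E); last first.
    have -> : E = (E `^ p^-1) `^ p by rewrite -powRrM mulVf ?gt_eqF// powRr1.
    by apply: ge0_ler_powR; rewrite ?nnegrE ?powR_ge0 ?(ltW p0).
  (* Only the product coefficients at indices 1 to [N] are kept: each is [a * s + b] times a test
     coefficient, whence the factor [N / N.+1]. The two boundary ones, at 0 and [N.+1], are
     discarded. *)
  apply: le_trans (series_powR_le_lim ccab N.+1).
  rewrite /series /= big_nat_recl//.
  rewrite (eq_big_nat _ _ (F2 := fun=> M `^ p * N.+1%:R^-1)); last first.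
    move=> k /andP[_ kN]; rewrite /affine_coef.
    have -> : a * c k.+1 + b * c k = (a * s + b) * c k.
      by rewrite /c ltnS kN ltnS (ltnW kN) exprS; ring.
    by rewrite modulusM powRM ?modulus_ge0// cE// ltnS ltnW.
  rewrite sumr_const_nat subn0 -[X in _ + X]mulr_natr mulrA mulrAC.
  by rewrite lerDr powR_ge0.
have : M `^ p <= m `^ p.
  apply/ler_addgt0Pr => e e0.
  (* The loss in [key] is [M^p / N.+1], which this choice of [N] makes smaller than [e]. *)
  have [N hN] : exists N : nat, M `^ p / e < N.+1%:R.
    exists (Num.truncn (M `^ p / e)); exact: truncnS_gt.
  have := key N; rewrite -natr1 in hN *.
  have N1 : 0 < N%:R + 1 :> R by rewrite natr1.
  rewrite -lerBlDr; apply: le_trans.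
  rewrite ltr_pdivrMr// in hN.
  have -> : N%:R / (N%:R + 1) = 1 - (N%:R + 1)^-1 :> R.
    by field; rewrite gt_eqF.
  rewrite mulrBr mulr1 lerD2l lerN2 ler_pdivrMr// mulrC.
  exact: ltW.
by apply: contraTT; rewrite -!ltNge => mM; apply: gt0_ltr_powR; rewrite ?nnegrE.
Qed.

(** * Exact norm for real coefficients *)

Lemma multiplier_norm_affine_real p (x y : R) : 1 <= p ->
  multiplier_norm p (affine x%:C%C y%:C%C) = `|x| + `|y|.
Proof.
move=> p1; apply/le_anti/andP; split.
  by rewrite -!modulus_real; exact: multiplier_norm_affine_le.
(* The unimodular parameter is a sign that aligns [x * t] with [y], so that their absolute values
   add up. *)
pose t : R := if (0 <= x) == (0 <= y) then 1 else -1.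
have t1 : modulus (t%:C%C : Cplx R) = 1.
  by rewrite modulus_real /t; case: ifP; rewrite ?normrN normr1.
have := multiplier_norm_affine_ge x%:C%C y%:C%C p1 t1.
rewrite -rmorphM -rmorphD modulus_real; apply: le_trans.
rewrite /t; case: (ger0P x) => x0; case: (ger0P y) => y0 /=.
- by rewrite mulr1 ger0_norm// addr_ge0.
- by rewrite mulrN1 ltr0_norm; lra.
- by rewrite mulrN1 ger0_norm; lra.
- by rewrite mulr1 ltr0_norm; lra.
Qed.

Lemma affine_realD (x y x' y' : R) :
  affine x%:C%C y%:C%C + affine x'%:C%C y'%:C%C =
  affine (x + x')%:C%C (y + y')%:C%C.
Proof. by apply/funext => z; rewrite !fctE /affine !rmorphD /=; ring. Qed.

Lemma affine_realB (x y x' y' : R) :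
  affine x%:C%C y%:C%C - affine x'%:C%C y'%:C%C =
  affine (x - x')%:C%C (y - y')%:C%C.
Proof. by apply/funext => z; rewrite !fctE /affine !rmorphB /=; ring. Qed.

End AffineMultipliers.

Theorem theorem5p4 (R : realType) (p : R) (hp : 1 < p) :
  forall C r : R, 0 < C -> 1 < r ->
    ~ LWP (multiplier p) (multiplier_norm p) C r /\
    ~ UWP (multiplier p) (multiplier_norm p) C r.
Proof.
move=> C r C0 r1; have p1 := ltW hp; have r0 : 0 < r by exact: lt_trans r1.
have two : 2 `^ r = 2 `^ (r - 1) * 2 :> R.
  by rewrite -[X in _ * X]powRr1// -powRD ?subrK// (gt_eqF r0).
split=> H.
(* At 1 and [z] the inequality reads [2^r + C * 2^r <= 2^r]. *)
- have := H _ _ (multiplier_affine 1%:C%C 0%:C%C p1)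
              (multiplier_affine 0%:C%C 1%:C%C p1).
  rewrite affine_realD affine_realB !multiplier_norm_affine_real//.
  rewrite !(addr0, add0r, subr0, sub0r, normrN, normr0, normr1) powR1 -two.
  by rewrite gerDl leNgt mulr_gt0// powR_gt0.
(* [t] solves [C * t^(r-1) = 1/2], so the term [C * t^r] is only half of [t]. *)
- pose t : R := (2 * C)^-1 `^ (r - 1)^-1.
  have t0 : 0 < t by rewrite powR_gt0// invr_gt0 mulr_gt0.
  have Ct : C * t `^ r = t / 2.
    have -> : t `^ r = t `^ (r - 1) * t.
      by rewrite -[X in _ * X](powRr1 (ltW t0)) -powRD ?subrK// (gt_eqF t0) implybT.
    rewrite /t -powRrM mulVf ?gt_eqF ?subr_gt0// powRr1 ?invr_ge0 ?mulr_ge0 ?ltW//.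
    by field; rewrite gt_eqF.
  have := H _ _ (multiplier_affine 1%:C%C t%:C%C p1)
              (multiplier_affine 1%:C%C (- t)%:C%C p1).
  rewrite affine_realD affine_realB !multiplier_norm_affine_real//.
  rewrite !(subrr, normrN, normr0, normr1, addr0, add0r) opprK.
  rewrite !gtr0_norm ?addr_gt0//.
  have -> : t + t = 2 * t by ring.
  have -> : 1 + 1 = 2 :> R by ring.
  (* Cancelling [2^r] leaves [(1 + t)^r <= 1 + t / 2], against [1 + t <= (1 + t)^r]. *)
  rewrite powRM ?(ltW t0)// mulrCA Ct two -mulrA -mulrDr ler_pM2l ?powR_gt0//.
  have : 1 + t <= (1 + t) `^ r.
    rewrite -[leLHS]powRr1 ?addr_ge0 ?(ltW t0)//.
    by apply: ler_powR; rewrite ?lerDl ltW.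
  by lra.
Qed.
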